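(* Let $b\in\mathbb{C}$ with $b^2\notin\{0,2,4,6,\dots\}$. The functions $\hat h_n(x)=\hat h_n(x;b)$, $n\in\mathbb{N}_0$, satisfy the 7th order recurrence relation $$(x+b)^3\hat h_n=(\mathsf J+b)^3\hat h_n+\tfrac32(\mathsf J+b)\left(\mathsf V\hat{\mathsf V}-\mathsf U\hat{\mathsf U}\right)\hat h_n+\tfrac32\left(\hat{\mathsf V}+\hat{\mathsf U}\right)\hat h_n.$$
   Context: $h_n(x)=\sum_{j=0}^{\lfloor n/2\rfloor}\frac{n!}{(n-2j)!\,j!}x^{n-2j}(-4)^{-j}$, $n\in\mathbb{N}_0$, are the monic Hermite polynomials, and $$\hat h_n(x;b)=(b^2-2n)h_n(x)-\frac{b\,h_n(x)+n\,h_{n-1}(x)}{x+b}.$$ $\mathsf S_n$ is the shift operator on sequences: $\mathsf S_n^kf_n=f_{n+k}$. The difference operators, acting on sequences indexed by $n$ (products denote composition, the rightmost operator acting first on the sequence), are $$\mathsf J=\mathsf S_n+\tfrac n2\mathsf S_n^{-1},\quad \mathsf U=b+n\mathsf S_n^{-1},\quad \hat{\mathsf U}=(b^2-2n)^{-1}\mathsf U,\quad \mathsf V=2\mathsf S_n+b,\quad \hat{\mathsf V}=(b^2-2n-2)^{-1}\mathsf V.$$ Terms with a negative index always carry a vanishing coefficient and are taken to be $0$. *)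

(* Defs.v *)
From HB Require Import structures.
From mathcomp Require Import all_boot all_order all_algebra.
From mathcomp Require Import complex reals.

Set Implicit Arguments.
Unset Strict Implicit.
Unset Printing Implicit Defensive.

Import GRing.Theory.
Local Open Scope ring_scope.

Declare Scope diffop_scope.
Delimit Scope diffop_scope with op.

Section DifferenceOperators.
Variable F : fieldType.

Definition diffop := (nat -> F) -> nat -> F.

Definition addop (A B : diffop) : diffop := fun f n => A f n + B f n.
Definition subop (A B : diffop) : diffop := fun f n => A f n - B f n.
Definition compop (A B : diffop) : diffop := fun f => A (B f).
Definition expop (A : diffop) (k : nat) : diffop := fun f => iter k A f.

Definition mulop (c : nat -> F) : diffop := fun f n => c n * f n.
Definition scalop (c : F) : diffop := mulop (fun=> c).

Definition shift : diffop := fun f n => f n.+1.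

(* Terms with a negative index are 0. *)
Definition shiftV : diffop := fun f n => if n is m.+1 then f m else 0.

End DifferenceOperators.

Bind Scope diffop_scope with diffop.
Arguments addop {F} (A B)%_op f n /.
Arguments subop {F} (A B)%_op f n /.
Arguments compop {F} (A B)%_op f n /.
Arguments expop {F} A%_op k%_N f n /.
Arguments mulop {F} c f n /.
Arguments scalop {F} c%_R f n /.
Arguments shift {F} f n /.
Arguments shiftV {F} f n /.

Notation "A + B" := (addop A B) : diffop_scope.
Notation "A - B" := (subop A B) : diffop_scope.
Notation "A * B" := (compop A B) : diffop_scope.
Notation "A ^+ k" := (expop A k) : diffop_scope.
Notation "c %:op" := (scalop c) (at level 2, format "c %:op") : diffop_scope.

Section Operators.
Variables (F : fieldType) (b : F).

Definition Jop : diffop F := (shift + mulop (fun n => n%:R / 2) * shiftV)%op.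

Definition Uop : diffop F := (b%:op + mulop (fun n => n%:R) * shiftV)%op.
Definition hatUop : diffop F :=
  (mulop (fun n => (b ^+ 2 - 2 * n%:R)^-1) * Uop)%op.

Definition Vop : diffop F := (2%:op * shift + b%:op)%op.
Definition hatVop : diffop F :=
  (mulop (fun n => (b ^+ 2 - 2 * n%:R - 2)^-1) * Vop)%op.

End Operators.

Arguments Jop {F}.

Section Hermite.
Variable F : fieldType.

Definition hermite (n : nat) : {poly F} :=
  \sum_(j < n./2.+1)
    ((n`!)%:R / ((n - 2 * j)`!%:R * (j`!)%:R) * (- 4) ^- j) *: 'X^(n - 2 * j).

(* For n = 0 the term in hermite n.-1 has coefficient 0.  The value at
   x = - b, where the function has a pole, is meaningless. *)
Definition hat_hermite (b : F) (n : nat) (x : F) : F :=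
  (b ^+ 2 - 2 * n%:R) * (hermite n).[x]
  - (b * (hermite n).[x] + n%:R * (hermite n.-1).[x]) / (x + b).

End Hermite.

(* Main.v *)
Require Import Defs.
From mathcomp Require Import all_boot all_order all_algebra.
From mathcomp Require Import complex reals.
From mathcomp Require Import boolp ring zify.

(** Put [g_n = n h_{n-1}].  The operators [S] and [n S^-1] act without division
    on the sequences [a(n) h_n + c(n) g_n]:
    [h_{n+1} = x h_n - g_n / 2], [g_{n+1} = (n + 1) h_n],
    [n h_{n-1} = g_n] and [n g_{n-1} = 2 x g_n - 2 n h_n].
    On [\hat h] the denominators of [\hat U] and [\hat V] cancel:
    [\hat U \hat h = U h - h / (x + b)] and [\hat V \hat h = V h + h / (x + b)].
    Both sides of the recurrence are therefore combinations of [h_n] and [g_n]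
    with explicit coefficients, which can be compared. *)

Set Implicit Arguments.
Unset Strict Implicit.
Unset Printing Implicit Defensive.

Import GRing.Theory Num.Theory.
Local Open Scope ring_scope.

Section HermiteRecurrence.
Variable F : numFieldType.
Implicit Type x : F.

(** The test on [2 * j] cuts off the indices at which the truncated [n - 2 * j] would give spurious
    terms, so Hermite sums of different degrees can share one range. *)
Definition hermite_term x (n j : nat) : F :=
  if (2 * j <= n)%N then
    (n`!)%:R / ((n - 2 * j)`!%:R * (j`!)%:R) * (- 4) ^- j * x ^+ (n - 2 * j)
  else 0.

Lemma factr_neq0 (n : nat) : (n`!)%:R != 0 :> F.
Proof. by rewrite pnatr_eq0 -lt0n fact_gt0. Qed.

Lemma horner_hermite x (n N : nat) : (n./2 < N)%N ->
  (hermite F n).[x] = \sum_(j < N) hermite_term x n j.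
Proof.
move=> ltnN; rewrite /hermite horner_sum (big_ord_widen _ (fun j =>
  ((n`!)%:R / ((n - 2 * j)`!%:R * (j`!)%:R) * (- 4) ^- j *: 'X^(n - 2 * j)).[x])
  ltnN) big_mkcond /=.
apply: eq_bigr => j _; rewrite /hermite_term hornerZ hornerXn.
by have -> : (j < n./2.+1)%N = (2 * j <= n)%N by lia.
Qed.

Lemma hermite_termS0 x (n : nat) :
  hermite_term x n.+1 0 = x * hermite_term x n 0.
Proof.
rewrite /hermite_term muln0 /= !subn0 fact0 expr0 exprS.
by field; rewrite !factr_neq0.
Qed.

(** After division by the common factors this is [n + 2 = (n - 2 j) + 2 (j + 1)]. *)
Lemma hermite_termSS x (n j : nat) :
  hermite_term x n.+2 j.+1 =
    x * hermite_term x n.+1 j.+1 - n.+1%:R / 2 * hermite_term x n j.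
Proof.
rewrite /hermite_term.
have -> : (2 * j.+1 <= n.+2)%N = (2 * j <= n)%N by lia.
have [le2jn|lt_n2j] := leqP (2 * j) n; last first.
  by rewrite ifF; [rewrite !mulr0 subr0 | lia].
have -> : (n.+2 - 2 * j.+1 = n - 2 * j)%N by lia.
have [k ->] : exists k, (n = 2 * j + k)%N by exists (n - 2 * j)%N; lia.
rewrite addKn.
have f4 : (- 4 : F) != 0 by rewrite oppr_eq0 pnatr_eq0.
have fj := factr_neq0 j; have fk := factr_neq0 k.
have j1 : j.+1%:R != 0 :> F by rewrite pnatr_eq0.
have f4j : (- 4 : F) ^+ j != 0 by rewrite expf_neq0.
(* For [k = 0] the term of degree [n + 1] lies outside its range and vanishes. *)
case: k fk => [|k] fk.
  rewrite addn0 ifF; last by lia.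
  rewrite !factS fact0 expr0 exprS !natrM.
  by field; rewrite fj f4j nat1r j1.
rewrite ifT; last by lia.
have -> : ((2 * j + k.+1).+1 - 2 * j.+1 = k)%N by lia.
move: fk; rewrite !factS !natrM mulf_eq0 negb_or => /andP[k1 fk].
rewrite !exprS.
by field; rewrite fj fk f4j !nat1r j1 k1.
Qed.

Lemma hermiteSS x (n : nat) :
  (hermite F n.+2).[x] =
    x * (hermite F n.+1).[x] - n.+1%:R / 2 * (hermite F n).[x].
Proof.
(* The sum for [n] is one term shorter: it is matched with the other two after their terms at
   [j = 0] are split off. *)
rewrite (@horner_hermite x n.+2 n.+2) ?(@horner_hermite x n.+1 n.+2)
  ?(@horner_hermite x n n.+1); try lia.
rewrite big_ord_recl [in RHS]big_ord_recl /= hermite_termS0.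
rewrite mulrDr -addrA; congr (_ + _).
rewrite !mulr_sumr -sumrB; apply: eq_bigr => j _.
exact: hermite_termSS.
Qed.

End HermiteRecurrence.

Section HermiteCombinations.
Variables (F : numFieldType) (x : F).
Implicit Types a c : F -> F.

Let h n := (hermite F n).[x].
Let g n := n%:R * h n.-1.

(** The coefficients are functions on [F], not on [nat], so that the backward shift gives a genuine
    [y - 1], also at [n = 0]. *)
Definition hermite_comb a c (n : nat) : F :=
  a n%:R * (hermite F n).[x] + c n%:R * (n%:R * (hermite F n.-1).[x]).

Lemma hermite1 : h 1 = x * h 0.
Proof.
by rewrite /h !(@horner_hermite _ _ _ 1) // !big_ord1 hermite_termS0.
Qed.

Lemma hermiteS n : h n.+1 = x * h n - g n / 2.
Proof.
rewrite /g; case: n => [|n]; first by rewrite hermite1 !mul0r subr0.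
by rewrite {1}/h hermiteSS -/(h _) -/(h _) /=; ring.
Qed.

Lemma shift_comb a c : shift (hermite_comb a c) =
  hermite_comb (fun y => x * a (y + 1) + (y + 1) * c (y + 1))
               (fun y => - a (y + 1) / 2).
Proof.
apply/funext => n; rewrite /hermite_comb /shift -/(h n.+1) hermiteS /=.
by rewrite -/(h n) -/(h n.-1) /g -natr1; ring.
Qed.

(** For positive indices, [hermiteS] solved for [g n] gives [g n = 2 x h n - 2 h n.+1]. At index 0
    both sides vanish, whatever the coefficients are at [-1]. *)
Lemma natr_shiftV_comb a c :
  (mulop (fun n => n%:R) * shiftV)%op (hermite_comb a c) =
  hermite_comb (fun y => - 2 * y * c (y - 1))
               (fun y => a (y - 1) + 2 * x * c (y - 1)).
Proof.
apply/funext => -[|n]; rewrite /hermite_comb /= ?mul0r ?mulr0 ?addr0 ?mul0r //.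
rewrite -/(h n) -/(h n.+1) hermiteS /g -/(h n.-1) -natr1 addrK.
by field.
Qed.

Lemma JD_comb b a c : (Jop + b%:op)%op (hermite_comb a c) =
  hermite_comb
    (fun y => x * a (y + 1) + (y + 1) * c (y + 1) - y * c (y - 1) + b * a y)
    (fun y => - a (y + 1) / 2 + a (y - 1) / 2 + x * c (y - 1) + b * c y).
Proof.
apply/funext => n.
transitivity (shift (hermite_comb a c) n +
  (mulop (fun n => n%:R) * shiftV)%op (hermite_comb a c) n / 2 +
  b * hermite_comb a c n).
  by rewrite /Jop /scalop /addop /compop /mulop; field.
rewrite shift_comb natr_shiftV_comb /hermite_comb.
by field.
Qed.

Lemma U_comb b a c : Uop b (hermite_comb a c) =
  hermite_comb (fun y => b * a y - 2 * y * c (y - 1))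
               (fun y => b * c y + a (y - 1) + 2 * x * c (y - 1)).
Proof.
apply/funext => n.
transitivity (b * hermite_comb a c n +
  (mulop (fun n => n%:R) * shiftV)%op (hermite_comb a c) n) => //.
by rewrite natr_shiftV_comb /hermite_comb; ring.
Qed.

Lemma V_comb b a c : Vop b (hermite_comb a c) =
  hermite_comb (fun y => 2 * (x * a (y + 1) + (y + 1) * c (y + 1)) + b * a y)
               (fun y => - a (y + 1) + b * c y).
Proof.
apply/funext => n.
transitivity (2 * shift (hermite_comb a c) n + b * hermite_comb a c n) => //.
by rewrite shift_comb /hermite_comb; field.
Qed.

Lemma hat_hermite_comb b : (fun n => hat_hermite b n x) =
  hermite_comb (fun y => b ^+ 2 - 2 * y - b / (x + b)) (fun=> - (x + b)^-1).
Proof.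
by apply/funext => n; rewrite /hat_hermite /hermite_comb; ring.
Qed.

(** By [U_comb] the coefficients of [U] on the sequence are [(b^2 - 2 y) (b - 1 / (x + b))] and
    [b^2 - 2 y]. *)
Lemma hatU_hat_hermite b : x + b != 0 -> (forall k, b ^+ 2 - 2 * k%:R != 0) ->
  hatUop b (fun n => hat_hermite b n x) =
  hermite_comb (fun=> b - (x + b)^-1) (fun=> 1).
Proof.
move=> xb0 b0; apply/funext => n; rewrite hat_hermite_comb.
rewrite /hatUop /compop /mulop U_comb /hermite_comb.
by field; rewrite xb0 b0.
Qed.

Lemma hatV_hat_hermite b : x + b != 0 -> (forall k, b ^+ 2 - 2 * k%:R != 0) ->
  hatVop b (fun n => hat_hermite b n x) =
  hermite_comb (fun=> 2 * x + b + (x + b)^-1) (fun=> - 1).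
Proof.
move=> xb0 b0; apply/funext => n; rewrite hat_hermite_comb.
rewrite /hatVop /compop /mulop V_comb /hermite_comb.
(* The denominator of [hatVop] at [n] is that of [hatUop] at [n + 1]. *)
have b2 : b ^+ 2 - 2 * n%:R - 2 != 0.
  by have := b0 n.+1; rewrite -[n.+1%:R]natr1 mulrDr mulr1 opprD addrA.
by field; rewrite xb0 b2.
Qed.

Lemma hermite_combB a c a' c' :
  (fun n => hermite_comb a c n - hermite_comb a' c' n) =
  hermite_comb (fun y => a y - a' y) (fun y => c y - c' y).
Proof. by apply/funext => n; rewrite /hermite_comb; ring. Qed.

Lemma hat_hermite_recurrence b n :
    x + b != 0 -> (forall k, b ^+ 2 - 2 * k%:R != 0) ->
  let h m := hat_hermite b m x in
  (x + b) ^+ 3 * h n =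
    ((Jop + b%:op) ^+ 3)%op h n
    + ((3 / 2)%:op * (Jop + b%:op) * (Vop b * hatVop b - Uop b * hatUop b))%op h n
    + ((3 / 2)%:op * (hatVop b + hatUop b))%op h n.
Proof.
move=> xb0 b0 h'.
have eq_h' : h' n = hermite_comb (fun y => b ^+ 2 - 2 * y - b / (x + b))
  (fun=> - (x + b)^-1) n by rewrite -hat_hermite_comb.
rewrite eq_h'.
(* These conversions expose operators applied to whole sequences, the form in which the lemmas on
   combinations rewrite. *)
have -> : ((3 / 2)%:op * (Jop + b%:op) *
             (Vop b * hatVop b - Uop b * hatUop b))%op h' n =
    3 / 2 * (Jop + b%:op)%op
      (fun m => Vop b (hatVop b h') m - Uop b (hatUop b h') m) n by [].
have -> : ((3 / 2)%:op * (hatVop b + hatUop b))%op h' n =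
    3 / 2 * (hatVop b h' n + hatUop b h' n) by [].
have -> : ((Jop + b%:op) ^+ 3)%op h' n =
    (Jop + b%:op)%op ((Jop + b%:op)%op ((Jop + b%:op)%op h')) n by [].
(* The difference of the two products equals [4 (x + b) (x h_n - g_n)], and the sum in the last term
   equals [2 (x + b) h_n]. *)
rewrite hatU_hat_hermite // hatV_hat_hermite // U_comb V_comb hermite_combB.
rewrite JD_comb /h' hat_hermite_comb !JD_comb /hermite_comb.
by field.
Qed.

End HermiteCombinations.

Theorem proposition5p2 (R : realType) (b : R[i])
    (hb : forall k : nat, b ^+ 2 <> (2 * k)%:R)
    (x : R[i]) (hx : x + b <> 0) (n : nat) :
  let h : nat -> R[i] := fun m => hat_hermite b m x in
  (x + b) ^+ 3 * h n =
    ((Jop + b%:op) ^+ 3)%op h n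
    + ((3 / 2)%:op * (Jop + b%:op) * (Vop b * hatVop b - Uop b * hatUop b))%op h n
    + ((3 / 2)%:op * (hatVop b + hatUop b))%op h n.
Proof.
apply: hat_hermite_recurrence; first exact/eqP.
by move=> k; rewrite subr_eq0 -natrM; apply/eqP.
Qed.
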